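(* There is no function $f: \mathbb{N} \rightarrow \mathbb{N}$ such that, for every $r \in \mathbb{N}$, every digraph $D$ with $\delta^+(D) \ge f(r)$ satisfies $\mathrm{sm}(D) \ge r$.
   Context: All digraphs are finite (with non-empty vertex set) and have no loops and no multiple edges (but both $uv$ and $vu$ may be edges). $\delta^+(D)$ denotes the minimum out-degree of $D$. A digraph is strongly-connected if for every ordered pair $(u,v)$ of vertices there is a directed path from $u$ to $v$. $\overrightarrow{K}_r$ is the digraph on $r$ vertices in which every pair of distinct vertices is joined by an edge in each direction. A digraph $D'$ is a strong $\overrightarrow{K}_r$ minor if $V(D')$ can be partitioned into $r$ non-empty sets (branch sets), each inducing a strongly-connected subdigraph, such that for any two distinct branch sets there is at least one edge in each direction between them. A digraph contains a strong $\overrightarrow{K}_r$ minor if some subdigraph of it is one. $\mathrm{sm}(D)$ is the largest $r$ such that $D$ contains a strong $\overrightarrow{K}_r$ minor. *)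

(* Defs.v *)
From HB Require Import structures.
From mathcomp Require Import all_boot.

Set Implicit Arguments.
Unset Strict Implicit.
Unset Printing Implicit Defensive.

(* Digraphs whose vertices are taken from an ambient finite type [T], given as  *)
(* a pair (vertex set, arc set); all digraphs of interest arise this way as [T] *)
(* varies, and the subdigraphs of [D : digraph T] are again in [digraph T].     *)
(* The empty vertex set is allowed here so that every [B : {set T}] induces a   *)
(* subdigraph; non-emptiness is required explicitly where it is intended.       *)
Definition digraph_axiom (T : finType) (G : {set T} * {set T * T}) : bool :=
  [forall u, forall v,
     ((u, v) \in G.2) ==> [&& u \in G.1, v \in G.1 & u != v]].

Record digraph (T : finType) : Type := Digraph {
  digraph_val : {set T} * {set T * T};
  digraph_valP : digraph_axiom digraph_val
}.

HB.instance Definition _ (T : finType) := [isSub of digraph T for @digraph_val T].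
HB.instance Definition _ (T : finType) := [Finite of digraph T by <:].

Section Digraphs.

Variable T : finType.
Implicit Types (D H : digraph T) (A B C : {set T}) (r : nat).

Definition vertices D : {set T} := (digraph_val D).1.

Definition arcs D : {set T * T} := (digraph_val D).2.

Definition subdigraph H D : bool :=
  (vertices H \subset vertices D) && (arcs H \subset arcs D).

Lemma induced_subproof D B :
  digraph_axiom (vertices D :&: B,
                 [set e in arcs D | (e.1 \in B) && (e.2 \in B)]).
Proof.
apply/forallP => u; apply/forallP => v; apply/implyP; rewrite !inE /=.
case/and3P => uv uB vB; rewrite uB vB !andbT.
by have /forallP/(_ u)/forallP/(_ v)/implyP/(_ uv) := digraph_valP D.
Qed.

Definition induced D B : digraph T := Digraph (induced_subproof D B).

Definition outdegree D (v : T) : nat := #|[set w | (v, w) \in arcs D]|.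

(* The default value is an upper bound of all out-degrees, so this is the       *)
(* genuine minimum as soon as [vertices D] is non-empty.                        *)
Definition min_outdegree D : nat :=
  \big[minn/#|vertices D|]_(v in vertices D) outdegree D v.

(* Directed paths cannot leave [vertices D], since arcs have both ends in it.   *)
Definition strongly_connected D : bool :=
  [forall u in vertices D, forall v in vertices D,
     connect [rel x y | (x, y) \in arcs D] u v].

(* [partition] forbids empty blocks; the quantification over ordered pairs of   *)
(* blocks yields an arc in each direction.                                      *)
Definition is_strong_clique_minor D r : bool :=
  [exists P : {set {set T}},
     [&& partition P (vertices D), #|P| == r,
         [forall B in P, strongly_connected (induced D B)]
       & [forall B in P, forall C in P, (B != C) ==>
            [exists u in B, exists v in C, (u, v) \in arcs D]]]].

Definition contains_strong_clique_minor D r : bool :=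
  [exists H : digraph T, subdigraph H D && is_strong_clique_minor H r].

(* Branch sets are non-empty and disjoint, so r <= #|vertices D|; the lemmas    *)
(* [contains_sm] and [contains_leq_sm] state that this is the largest r.        *)
Definition sm D : nat :=
  \max_(r < #|vertices D|.+1 | contains_strong_clique_minor D r) r.

Lemma contains_leq_card D r :
  contains_strong_clique_minor D r -> r <= #|vertices D|.
Proof.
case/existsP => H /andP[/andP[sV _] /existsP[P /and4P[pP /eqP <- _ _]]].
apply: leq_trans (subset_leq_card sV); rewrite (card_partition pP) -sum1_card.
apply: leq_sum => B BP; rewrite card_gt0.
by case/and3P: pP => _ _; apply: contraNneq => <-.
Qed.

Lemma contains_leq_sm D r : contains_strong_clique_minor D r -> r <= sm D.
Proof.
move=> Dr; have := contains_leq_card Dr; rewrite -ltnS => lt_r.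
exact: (leq_bigmax_cond (Ordinal lt_r)).
Qed.

Lemma contains0 D : contains_strong_clique_minor D 0.
Proof.
apply/existsP; exists (induced D set0); apply/andP; split.
  apply/andP; split; first exact: subsetIl.
  by apply/subsetP => e; rewrite inE => /andP[].
apply/existsP; exists set0; rewrite cards0 eqxx /=.
have -> : vertices (induced D set0) = set0 by rewrite /vertices /= setI0.
rewrite /partition /cover /trivIset /cover !big_set0 cards0 !inE !eqxx /=.
by apply/andP; split; apply/forallP => B; rewrite inE.
Qed.

Lemma contains_sm D : contains_strong_clique_minor D (sm D).
Proof.
rewrite /sm; elim/big_ind: _ => // [|m n Dm Dn]; first exact: contains0.
by rewrite /maxn; case: ifP.
Qed.

Lemma outdegree_leq_card D v : outdegree D v <= #|vertices D|.
Proof.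
apply/subset_leq_card/subsetP => w; rewrite inE => vw.
by have /forallP/(_ v)/forallP/(_ w)/implyP/(_ vw)/and3P[] := digraph_valP D.
Qed.

Lemma leq_min_outdegree D d : vertices D != set0 ->
  (d <= min_outdegree D) = [forall v in vertices D, d <= outdegree D v].
Proof.
case/set0Pn => v0 v0D; apply/idP/forall_inP => [le_d v vD | le_d].
  move: le_d; rewrite /min_outdegree.
  elim: (index_enum T) (mem_index_enum v) => // w s IHs; rewrite big_cons inE.
  case/predU1P => [<- | vs]; first by rewrite vD leq_min => /andP[].
  by case: ifP => _; [rewrite leq_min => /andP[_] |]; apply: IHs.
rewrite /min_outdegree; elim/big_ind: _ => [|m n|v /le_d //].
  exact: leq_trans (le_d _ v0D) (outdegree_leq_card D v0).
by rewrite leq_min => -> ->.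
Qed.

End Digraphs.

(* Main.v *)
Require Import Defs.
From mathcomp Require Import all_boot.

(** Already [r = 3] defeats every candidate [f].  Take the complete [k]-ary
    tree of height [k] with arcs directed away from the root, and let each leaf
    send an arc back to each of its [k] proper ancestors.  Internal vertices
    have [k] children and leaves have [k] proper ancestors, so every out-degree
    is [k].

    The only way to enter the subtree below a vertex [t] is through [t] itself,
    from the parent of [t], because back arcs go to ancestors
    ([arc_entering_subtree]).  Hence a strongly connected branch set has a
    vertex of least depth, its top, and lies inside the subtree of that top
    ([top_exists]).  Let [A] and [C] be disjoint branch sets such that the top
    [t] of [C] is at least as deep as that of [A].  Then the top of [A] is
    outside the subtree of [t], hence so is all of [A], which could enter that
    subtree only through [t].  So any arc from [A] to [C] starts at the parent
    of [t], and this parent lies in [A] ([parent_of_deeper_top]).  Applied to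
    the branch set whose top is deepest, this puts the parent of that top into
    every other branch set, so there is at most one other
    ([sm_leaf_back_tree]). *)

Set Implicit Arguments.
Unset Strict Implicit.
Unset Printing Implicit Defensive.

Lemma connect_invariant (T : finType) (e : rel T) (P : pred T) (x y : T) :
  (forall u v, e u v -> P u -> P v) -> connect e x y -> P x -> P y.
Proof.
move=> eP /connectP[p + ->]; elim: p x => //= z p IHp x /andP[xz zp] Px.
exact: IHp zp (eP _ _ xz Px).
Qed.

Lemma prefix_total_size (A : eqType) (s t x : seq A) :
  prefix s x -> prefix t x -> size s <= size t -> prefix s t.
Proof.
rewrite !prefixE => /eqP sx /eqP tx le_st.
by rewrite -tx take_takel // sx.
Qed.

Section LeafBackTree.

Variable k : nat.

(** A vertex of the tree is the word of child indices that leads to it from the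
    root, so that [prefix] is the ancestor relation. *)
Notation node := (k.-bseq 'I_k).

Implicit Types (u v t x y : node) (A B C : {set node}) (H : digraph node).

Definition leaf_back_arc u v : bool :=
  (prefix u v && (size v == (size u).+1))
  || [&& size u == k, prefix v u & u != v].

Lemma leaf_back_axiom :
  digraph_axiom ([set: node], [set e | leaf_back_arc e.1 e.2]).
Proof.
apply/forallP => u; apply/forallP => v; apply/implyP; rewrite !inE /=.
case/orP=> [/andP[_ /eqP uv]|/and3P[]//].
by apply/eqP => eq_uv; move: uv; rewrite eq_uv => /n_Sn.
Qed.

Definition leaf_back_tree : digraph node := Digraph leaf_back_axiom.

Lemma outdegree_leaf_back_tree u : k <= outdegree leaf_back_tree u.
Proof.
rewrite /outdegree.
(* [g] enumerates the children of an internal node, the ancestors of a leaf *)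
have [g g_inj g_arc] : exists2 g : 'I_k -> node,
    injective g & forall i, leaf_back_arc u (g i).
  have := size_bseq u; rewrite leq_eqVlt => /orP[/eqP szu|ltu].
  - have sz_t (i : 'I_k) : size (take i u) = i by rewrite size_takel ?szu 1?ltnW.
    have le_t (i : 'I_k) : size (take i u) <= k by rewrite sz_t ltnW.
    exists (fun i => Bseq (le_t i)) => [i j /(congr1 val)/(congr1 size)|i].
      by rewrite /= !sz_t => /ord_inj.
    apply/orP; right; rewrite szu eqxx prefix_take /=.
    apply/eqP => /(congr1 val)/(congr1 size)/=; rewrite sz_t szu => ki.
    by have := ltn_ord i; rewrite -ki ltnn.
  - have le_r (i : 'I_k) : size (rcons u i) <= k by rewrite size_rcons.
    exists (fun i => Bseq (le_r i)) => [i j /(congr1 val)/rcons_inj[]//|i].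
    by rewrite /leaf_back_arc /= prefix_rcons size_rcons eqxx.
have card_g : #|[set g i | i in 'I_k]| = k by rewrite card_imset ?card_ord.
apply: leq_trans (eq_leq (esym card_g)) _.
apply/subset_leq_card/subsetP => _ /imsetP[i _ ->].
by rewrite !inE; apply: g_arc.
Qed.

Lemma min_outdegree_leaf_back_tree : k <= min_outdegree leaf_back_tree.
Proof.
rewrite leq_min_outdegree; last by apply/set0Pn; exists [bseq]; rewrite inE.
by apply/forall_inP => u _; apply: outdegree_leaf_back_tree.
Qed.

(** A back arc ends at an ancestor of its source, so if it ends in the subtree of
    [t] it also starts there; only a tree arc can enter, at [t] itself.  The
    word [take (size t).-1 t] is the parent of [t]; the root of the tree has no
    parent, but it is a prefix of every [u]. *)
Lemma arc_entering_subtree t u v :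
    leaf_back_arc u v -> prefix t v -> ~~ prefix t u ->
  v = t /\ take (size t).-1 t = u.
Proof.
case/orP=> [/andP[uv /eqP szv] tv|/and3P[_ vu _] tv]; last first.
  by rewrite (prefix_trans tv vu).
have := size_prefix tv; rewrite leq_eqVlt => /orP[/eqP szt _|]; last first.
  by rewrite szv ltnS => le_tu; rewrite (prefix_total_size tv uv le_tu).
have vt : v = t.
  by apply: val_inj => /=; move: tv; rewrite prefixE szt take_size => /eqP.
by split=> //; rewrite szt szv -vt; apply/eqP; rewrite -prefixE.
Qed.

Definition is_top t B : bool := (t \in B) && [forall x in B, prefix t x].

(** [t] is a vertex of [B] of least depth.  An arc leaves the subtree of [t] only
    towards a proper ancestor of [t], and these are too shallow to be in [B]. *)
Lemma top_exists H B :
    arcs H \subset arcs leaf_back_tree -> B \subset vertices H ->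
    strongly_connected (induced H B) -> B != set0 ->
  exists t, is_top t B.
Proof.
move=> sH sB /forall_inP sc /set0Pn[b bB].
have inV x : x \in B -> x \in vertices (induced H B).
  by move=> xB; rewrite inE (subsetP sB).
case: (arg_minnP (fun x : node => size x) bB) => t tB t_min.
exists t; apply/andP; split=> //; apply/forall_inP => x xB.
have := forall_inP (sc t (inV t tB)) x (inV x xB) => tx.
pose in_subtree y := prefix t y.
apply: (connect_invariant (P := in_subtree) _ tx (prefix_refl t)).
move=> y z /=.
rewrite inE => /and3P[/(subsetP sH)]; rewrite inE /= => yz yB zB ty.
case/orP: yz => [/andP[yz _]|/and3P[_ zy _]]; first exact: prefix_trans ty yz.
exact: prefix_total_size ty zy (t_min z zB).
Qed.

(** The inequality of depths and [t \notin A] make the top of [A] avoid the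
    subtree of [t]; since [A] is strongly connected, all of [A] does. *)
Lemma parent_of_deeper_top H A C s t :
    arcs H \subset arcs leaf_back_tree -> A \subset vertices H ->
    strongly_connected (induced H A) -> [disjoint A & C] ->
    is_top s A -> is_top t C -> size s <= size t ->
    [exists u in A, exists v in C, (u, v) \in arcs H] ->
  exists2 u, u \in A & take (size t).-1 t = u.
Proof.
move=> sH sA /forall_inP sc dAC /andP[sinA _] /andP[tC /forall_inP tmin] le_st.
have tA : t \notin A by apply: contraTN tC => /(disjointFr dAC) ->.
have inV x : x \in A -> x \in vertices (induced H A).
  by move=> xA; rewrite inE (subsetP sA).
have Nts : ~~ prefix t s.
  apply: contra tA => ts; suff -> : t = s by [].
  apply: val_inj => /=; move: ts; rewrite prefixE take_oversize //.
  by move=> /eqP.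
case/exists_inP => u uA /exists_inP[v vC /(subsetP sH)]; rewrite inE /= => uv.
suff Ntu : ~~ prefix t u.
  by exists u => //; case: (arc_entering_subtree uv (tmin v vC) Ntu).
have su := forall_inP (sc s (inV s sinA)) u (inV u uA).
apply: (connect_invariant (P := fun x : node => ~~ prefix t x) _ su Nts).
move=> y z /=; rewrite inE => /and3P[/(subsetP sH)]; rewrite inE /=.
move=> yz yA zA Nty; apply: contra tA => tz.
by case: (arc_entering_subtree yz tz Nty) => <-.
Qed.

Lemma sm_leaf_back_tree : sm leaf_back_tree <= 2.
Proof.
rewrite leqNgt; apply/negP => sm3.
case/existsP: (contains_sm leaf_back_tree) => H /andP[/andP[_ sH]].
case/existsP => P /and4P[partP /eqP cardP /forall_inP sc /forall_inP adj].
have /and3P[/eqP covP /trivIsetP trivP P0] := partP.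
have sub B : B \in P -> B \subset vertices H.
  by move=> BP; rewrite -covP; apply: bigcup_sup.
have ex_top B : B \in P -> exists t, is_top t B.
  move=> BP; apply: top_exists sH (sub B BP) (sc B BP) _.
  by apply: contraNneq P0 => <-.
have [B0 B0P] : exists B0, B0 \in P.
  by apply/set0Pn; rewrite -card_gt0 cardP; apply: leq_trans sm3.
have [t0 t0B0] := ex_top B0 B0P.
pose P_top t := [exists B in P, is_top t B].
have Pt0 : P_top t0 by apply/exists_inP; exists B0.
(* [C] is the branch set whose top [t] is deepest *)
case: (arg_maxnP (P := P_top) (fun x : node => size x) Pt0) => t.
move=> /exists_inP[C CP tC] t_max.
have parent B : B \in P -> B != C ->
    exists2 u, u \in B & take (size t).-1 t = u.
  move=> BP BC; have [s sB] := ex_top B BP.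
  have dBC := trivP B C BP CP BC.
  apply: (parent_of_deeper_top sH (sub B BP) (sc B BP) dBC sB tC).
    by apply: t_max; apply/exists_inP; exists B.
  by have /forall_inP/(_ C CP)/implyP/(_ BC) := adj B BP.
have : 1 < #|P :\ C| by move: sm3; rewrite -cardP (cardsD1 C) CP.
case/card_gt1P => A [B [/setD1P[AC AP] /setD1P[BC BP] AB]].
have [u uA tu] := parent A AP AC; have [v vB tv] := parent B BP BC.
have uv : u = v by apply: val_inj; rewrite /= -tu -tv.
by have := disjointFr (trivP A B AP BP AB) uA; rewrite uv vB.
Qed.

End LeafBackTree.

Theorem theorem1p4 :
  ~ exists f : nat -> nat,
      forall (r : nat) (T : finType) (D : digraph T),
        vertices D != set0 -> f r <= min_outdegree D -> r <= sm D.
Proof.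
case=> f fP.
have V0 : vertices (leaf_back_tree (f 3)) != set0.
  by apply/set0Pn; exists [bseq]; rewrite inE.
have := fP 3 _ _ V0 (min_outdegree_leaf_back_tree (f 3)).
by rewrite leqNgt ltnS sm_leaf_back_tree.
Qed.
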